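(* Let $\epsilon>0$, $k\ge 8/\epsilon$, and $C\le\sqrt{\frac{\epsilon m}{4k}}$. Suppose each of the $n$ items is sent to at most $C$ of the $m$ machines at random, and each machine may output at most $k'=\frac{\epsilon(1-\epsilon)}{8C}\cdot\frac nm$ items. Then there exists a family of instances of monotone submodular (in fact coverage) maximization under cardinality constraint $k$ for which no algorithm can guarantee a core-set of expected value more than $(1-\frac1e+\epsilon)$ times the optimum; i.e., for any per-machine algorithm $\mathsf{ALG}$, $\mathbb E[f_k(\bigcup_i\mathsf{ALG}(T_i))]\le(1-\frac1e+\epsilon)\max_{|S|\le k}f(S)$ on some instance of the family, where $T_i$ is the set of items sent to machine $i$.
   Context: For a finite ground set $\mathbb N$ and $f:2^{\mathbb N}\to\mathbb R_{\ge0}$, $f_k(S)=\max_{S'\subseteq S,|S'|\le k}f(S')$. A coverage function: items are subsets of a universe $\mathbb U$ and $f(S)=|\bigcup_{A\in S}A|$. Each item is sent to at least one machine. *)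

(* Defs.v *)
(* Plain MathComp; MathComp-Analysis only for the reals and expR. *)
From mathcomp Require Import all_boot all_order all_algebra.
From mathcomp Require Import reals.

Set Implicit Arguments.
Unset Strict Implicit.
Unset Printing Implicit Defensive.

Import Order.TTheory GRing.Theory Num.Theory.
Local Open Scope ring_scope.

(* An item is a subset of the universe U, so the machines see the items
   themselves; the objective is f(S) = |\bigcup_(A in S) A|. *)
Definition coverage (R : realType) (U : finType) (S : {set {set U}}) : R :=
  #|cover S|%:R.

(* f_k(S). The default value 0 of the maximum is harmless because f is
   nonnegative and S' = set0 always belongs to the range. *)
Definition best (R : realType) (I : finType) (f : {set I} -> R) (k : nat)
    (S : {set I}) : R :=
  \big[Num.max/0]_(S' : {set I} | (S' \subset S) && (#|S'| <= k)%N) f S'.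

Definition is_distr (R : realType) (I : finType) (P : I -> R) : Prop :=
  (forall x, 0 <= P x) /\ \sum_x P x = 1.

(* The law of the set of machines receiving one item: at least one and at most
   C of the m machines, chosen uniformly at random once their number is known.
   The number of recipients may itself be fixed or random. *)
Definition sending_law (R : realType) (m C : nat) (D : {set 'I_m} -> R) : Prop :=
  [/\ is_distr D,
      forall X : {set 'I_m}, D X != 0 -> (0 < #|X| <= C)%N
    & forall X Y : {set 'I_m}, #|X| = #|Y| -> D X = D Y].

(* ALG T S is the probability that a machine holding T outputs S; deterministic
   algorithms are the point masses. The bound k' need not be an integer. *)
Definition machine_algorithm (R : realType) (U : finType) (k' : R)
    (ALG : {set {set U}} -> {set {set U}} -> R) : Prop :=
  forall T, is_distr (ALG T) /\
    forall S : {set {set U}}, ALG T S != 0 -> S \subset T /\ #|S|%:R <= k'.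

(* The items of an instance are A 0, ..., A (n - 1). *)
Definition items (U : finType) (n : nat) (A : {ffun 'I_n -> {set U}}) :
    {set {set U}} :=
  [set A j | j : 'I_n].

(* X j is the set of machines to which the item A j is sent. *)
Definition received (U : finType) (n m : nat) (A : {ffun 'I_n -> {set U}})
    (X : {ffun 'I_n -> {set 'I_m}}) (i : 'I_m) : {set {set U}} :=
  [set A j | j : 'I_n & i \in X j].

(* E[f_k(\bigcup_i ALG(T_i))]: the items are sent independently, item j with
   law D j, and then the machines run ALG with independent coin tosses, machine
   i producing O i. *)
Definition expected_coreset_value (R : realType) (U : finType) (n m k : nat)
    (D : 'I_n -> {set 'I_m} -> R)
    (ALG : {set {set U}} -> {set {set U}} -> R)
    (A : {ffun 'I_n -> {set U}}) : R :=
  \sum_(X : {ffun 'I_n -> {set 'I_m}}) (\prod_j D j (X j)) *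
    \sum_(O : {ffun 'I_m -> {set {set U}}})
      (\prod_i ALG (received A X i) (O i)) *
      best (@coverage R U) k (\bigcup_i O i).

(* Main.v *)
(* The planted instance lives on the functions u from a set of coordinates to a
   k-element set, and every item prescribes the value of u at one coordinate.
   The k items indexed by J prescribe all possible values at one common
   coordinate and so partition the universe; every other item has a coordinate
   of its own, so that r of them cover only the fraction 1 - (1 - 1/k)^r. The
   family consists of the images of this instance under the permutations of the
   universe.

   A machine whose load T contains a single item of J cannot recognise it: a
   permutation of the universe exchanges it with any other item of the load and
   fixes the rest. On average over the family it is output with probability at
   most k'/|T|. Summed over machines and items, 1/|T| gives at most m, hence
   some k-subset J receives at most its share k m/n. Two items of J meet on some
   machine for at most k^2 C^2/m pairs in expectation. So the core-set contains
   on average at most a fraction k' m/n + k C^2/m <= 3 eps/8 of J, and its best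
   k items cover at most a fraction 1 - (1 - 1/k)^k + 3 eps/8 of the universe.

   When k' < 1 nothing is output, and any instance works. *)

Require Import Defs.
From mathcomp Require Import all_boot all_order all_algebra all_fingroup.
From mathcomp Require Import reals sequences exp.
From mathcomp Require Import ring lra zify.
Import Order.TTheory GRing.Theory Num.Theory.
Local Open Scope ring_scope.
Set Implicit Arguments.
Unset Strict Implicit.
Unset Printing Implicit Defensive.

(** * Light subsets by averaging *)

(** Starting from the whole of [I], a heaviest element is deleted repeatedly; this never raises the
    average weight. *)
Lemma light_subset (R : realFieldType) (I : finType) (w : I -> R) (k : nat) :
  (k <= #|I|)%N ->
  exists2 J : {set I}, #|J| = k &
    #|I|%:R * \sum_(j in J) w j <= k%:R * \sum_j w j.
Proof.
move=> lekI; rewrite -(subKn lekI).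
have: (#|I| - k <= #|I|)%N by apply: leq_subr.
elim: (#|I| - k)%N => [|d IHd] ltdI.
  exists [set: I]; first by rewrite cardsT subn0.
  by rewrite subn0 (eq_bigl xpredT) // => j; rewrite inE.
have [J cardJ leJ] := IHd (ltnW ltdI).
set k' := (#|I| - d.+1)%N.
have cardJS : #|J| = k'.+1 by rewrite cardJ /k'; lia.
have /set0Pn[j0 j0J] : J != set0 by rewrite -card_gt0 cardJS.
(* [x] is a heaviest element of [J], so the [k'] elements that remain weigh at most [k' * w x]
   together. *)
case: (@arg_maxP _ _ _ j0 (fun j => j \in J) w j0J) => x xJ wx.
exists (J :\ x); first by have := cardsD1 x J; rewrite xJ cardJS => -[].
rewrite -cardJ cardJS (big_setD1 _ xJ) /= in leJ.
have sumx : \sum_(j in J :\ x) w j <= k'%:R * w x.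
  have <- : #|J :\ x| = k' by have := cardsD1 x J; rewrite xJ cardJS => -[].
  by rewrite mulr_natl -sumr_const; apply: ler_sum => j /setD1P[_ /wx].
rewrite -(ler_pM2l (ltr0Sn R k')).
have : #|I|%:R * \sum_(j in J :\ x) w j <= #|I|%:R * (k'%:R * w x).
  exact: ler_wpM2l.
have : k'%:R * (#|I|%:R * (w x + \sum_(j in J :\ x) w j)) <=
       k'%:R * (k'.+1%:R * \sum_j w j) by apply: ler_wpM2l.
rewrite -natr1.
set s := \sum_(_ in _) _; set N : R := #|I|%:R; set W := \sum_j w j.
by lra.
Qed.

(** * Expectations under product laws *)

Lemma sum_prod_marginals (R : comPzRingType) (I T : finType)
    (p g : I -> T -> R) :
  \sum_(f : {ffun I -> T}) (\prod_i p i (f i)) * \prod_i g i (f i) =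
  \prod_i \sum_x p i x * g i x.
Proof.
by rewrite bigA_distr_bigA; apply: eq_bigr => f _; rewrite big_split.
Qed.

Lemma sum_prod_marginal1 (R : comPzRingType) (I T : finType)
    (p : I -> T -> R) (i : I) (g : T -> R) :
  (forall j, \sum_x p j x = 1) ->
  \sum_(f : {ffun I -> T}) (\prod_j p j (f j)) * g (f i) =
  \sum_x p i x * g x.
Proof.
move=> p1.
pose h j := if j == i then g else fun=> 1.
under eq_bigr => f _.
  have -> : g (f i) = \prod_j h j (f j).
    by rewrite (bigD1 i) //= /h eqxx big1 ?mulr1 // => j /negPf ->.
  over.
rewrite sum_prod_marginals (bigD1 i) //= [X in _ * X]big1 => [|j ji].
  by rewrite mulr1 /h eqxx.
by rewrite -[RHS](p1 j); apply: eq_bigr => x _; rewrite /h (negPf ji) mulr1.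
Qed.

Lemma sum_prod_marginal2 (R : comPzRingType) (I T : finType)
    (p : I -> T -> R) (i l : I) (g h : T -> R) :
  (forall j, \sum_x p j x = 1) -> i != l ->
  \sum_(f : {ffun I -> T}) (\prod_j p j (f j)) * (g (f i) * h (f l)) =
  (\sum_x p i x * g x) * (\sum_x p l x * h x).
Proof.
move=> p1 il.
have li : l != i by rewrite eq_sym.
pose u j := if j == i then g else if j == l then h else fun=> 1.
under eq_bigr => f _.
  have -> : g (f i) * h (f l) = \prod_j u j (f j).
    rewrite (bigD1 i) //= (bigD1 l) //= /u !eqxx (negPf li).
    rewrite big1 ?mulr1 // => j.
    by case/andP=> /negPf -> /negPf ->.
  over.
rewrite sum_prod_marginals (bigD1 i) //= (bigD1 l) //=.
rewrite [X in _ * (_ * X)]big1 => [|j].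
  by rewrite mulr1 /u !eqxx (negPf li).
case/andP=> /negPf ji /negPf jl; rewrite -[RHS](p1 j).
by apply: eq_bigr => x _; rewrite /u ji jl mulr1.
Qed.

Lemma sum_prod_distr (R : comPzRingType) (I T : finType) (p : I -> T -> R) :
  (forall j, \sum_x p j x = 1) ->
  \sum_(f : {ffun I -> T}) \prod_j p j (f j) = 1.
Proof.
by move=> p1; rewrite -bigA_distr_bigA big1.
Qed.

(** * Comparison with the exponential *)

(** For k > 1, 1 + 1/(k-1) <= e^(1/(k-1)) gives (1 - 1/k)^(k-1) >= 1/e. The remaining factor 1 - 1/k
    costs at most 1/(e k) <= 1/k. *)
Lemma exp_subinv_ge (R : realType) (k : nat) : (0 < k)%N ->
  1 - (1 - k%:R^-1) ^+ k <= 1 - (expR 1)^-1 + k%:R^-1 :> R.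
Proof.
case: k => // k _.
have k1_gt0 : 0 < k.+1%:R :> R by [].
have e_gt0 : 0 < expR 1 :> R by apply: expR_gt0.
have e_ge1 : (expR 1)^-1 <= 1 :> R.
  by rewrite invf_le1 // -[leLHS]expR0 ler_expR.
have -> : 1 - k.+1%:R^-1 = k%:R / k.+1%:R :> R.
  by rewrite -natr1; field; rewrite natr1 gt_eqF.
suff : (expR 1)^-1 <= (k%:R / k.+1%:R) ^+ k :> R.
  move=> le_e.
  have : (expR 1)^-1 * (k%:R / k.+1%:R) <= (k%:R / k.+1%:R) ^+ k.+1 :> R.
    by rewrite exprSr ler_wpM2r // divr_ge0.
  have -> : k%:R / k.+1%:R = 1 - k.+1%:R^-1 :> R.
    by rewrite -natr1; field; rewrite natr1 gt_eqF.
  have : (expR 1)^-1 * k.+1%:R^-1 <= k.+1%:R^-1 :> R.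
    by apply: ler_piMl => //; rewrite invr_ge0.
  set z := k.+1%:R^-1; set x := (1 - z) ^+ k.+1; set y := (expR 1)^-1.
  by move: x y => x y; move: z x => z x; lra.
case: k k1_gt0 => [|k] k1_gt0; first by rewrite expr0.
have k_neq0 : k.+1%:R != 0 :> R by rewrite pnatr_eq0.
have -> : k.+1%:R / k.+2%:R = (1 + k.+1%:R^-1)^-1 :> R.
  have -> : k.+2%:R = k.+1%:R + 1 :> R by rewrite natr1.
  move: k_neq0 (ltr0Sn R k); set x := k.+1%:R => x0 x_gt0.
  by field; rewrite ?x0 gt_eqF //; lra.
rewrite exprVn lef_pV2 ?posrE //; last first.
  by rewrite exprn_gt0 // ltr_wpDr // invr_ge0.
have -> : expR 1 = expR k.+1%:R^-1 ^+ k.+1 :> R.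
  by rewrite -expRM_natl mulfV.
apply: lerXn2r; rewrite ?nnegrE ?expR_ge0 //.
  by rewrite addr_ge0 // invr_ge0.
by rewrite expR_ge1Dx.
Qed.

(** * Relabelling the universe and exchangeability *)

Definition relabel (I U : finType) (B : I -> {set U}) (s : {perm U}) :
    {ffun I -> {set U}} := [ffun j => s @: B j].

Lemma imset_permM (U : finType) (s t : {perm U}) (Y : {set U}) :
  (s * t)%g @: Y = t @: (s @: Y).
Proof.
by rewrite -imset_comp; apply: eq_imset => u /=; rewrite permM.
Qed.

Lemma relabel_inj (I U : finType) (B : I -> {set U}) (s : {perm U}) :
  injective B -> injective (relabel B s).
Proof.
move=> injB j l; rewrite !ffunE => /(imset_inj (@perm_inj _ s)); exact: injB.
Qed.

(** Here [q S x] stands for the probability that [x] is output from the load [S]. The swaps make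
    every item of the load as likely as [j] on average over [s], and for each [s] these
    probabilities add up to at most [K]. *)
Lemma exchangeable_selection (R : numDomainType) (I U : finType)
    (B : I -> {set U}) (T : {set I}) (j : I)
    (q : {set {set U}} -> {set U} -> R) (K : R) :
  injective B -> j \in T ->
  (forall S x, 0 <= q S x) -> (forall S, \sum_x q S x <= K) ->
  (forall l, l \in T -> exists s : {perm U},
     [/\ s @: B j = B l, s @: B l = B j
       & forall a, a \in T -> a != j -> a != l -> s @: B a = B a]) ->
  #|T|%:R * \sum_s q (relabel B s @: T) (relabel B s j) <=
  #|{perm U}|%:R * K.
Proof.
move=> injB jT q_ge0 q_le swap.
have exch l : l \in T ->
  \sum_s q (relabel B s @: T) (relabel B s j) =
  \sum_s q (relabel B s @: T) (relabel B s l).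
  move=> lT; have [t [tj tl ta]] := swap l lT.
  (* In [t * s] the swap [t] acts first: it maps the unrelabelled load to itself and turns [B j]
     into [B l]. *)
  rewrite (reindex_inj (mulgI t)); apply: eq_bigr => s _.
  congr (q _ _); last by rewrite !ffunE imset_permM tj.
  have relE a : relabel B (t * s)%g a = s @: (t @: B a).
    by rewrite ffunE imset_permM.
  apply/setP=> x; apply/imsetP/imsetP => -[a aT ->]; rewrite ?relE ?ffunE.
    have [->|aj] := eqVneq a j; first by exists l; rewrite ?ffunE ?tj.
    have [->|al] := eqVneq a l; first by exists j; rewrite ?ffunE ?tl.
    by exists a; rewrite ?ffunE ?ta.
  have [->|aj] := eqVneq a j; first by exists l; rewrite ?relE ?tl.
  have [->|al] := eqVneq a l; first by exists j; rewrite ?relE ?tj.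
  by exists a; rewrite ?relE ?ta.
rewrite mulr_natl -sumr_const (eq_bigr _ exch) exchange_big /=.
rewrite mulr_natl -sumr_const; apply: ler_sum => s _.
rewrite -(big_imset (q (relabel B s @: T))) /=; last first.
  by move=> a b _ _; apply: relabel_inj.
apply: le_trans (q_le (relabel B s @: T)).
by rewrite [leLHS]big_mkcond /=; apply: ler_sum => x _; case: ifP.
Qed.

(** * The planted instance and its symmetries *)

(** The coordinate that item [j] prescribes: [None] is the one common to [J], [Some j] the private
    one. *)
Definition block (I : finType) (J : {set I}) (j : I) : option I :=
  if j \in J then None else Some j.

Definition planted (I V : finType) (J : {set I}) (v : I -> V) (j : I) :
    {set {ffun option I -> V}} :=
  [set u : {ffun option I -> V} | u (block J j) == v j].

Lemma planted_inj (I V : finType) (J : {set I}) (v : I -> V) :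
  (1 < #|V|)%N -> {in J &, injective v} -> injective (planted J v).
Proof.
move=> V_gt1 v_inj j l /setP eq_jl.
have blockE : block J j = block J l.
  apply/eqP/negP => /negP; rewrite eq_sym => neq_b.
  have /card_gt0P[y] : (0 < #|predC1 (v l)|)%N.
    by have := cardC1 (v l); lia.
  rewrite inE => neq_y.
  (* With distinct coordinates, this function lies in item [j] but misses item [l], since [y]
     differs from [v l]. *)
  have := eq_jl [ffun c => if c == block J j then v j else y].
  rewrite !inE !ffunE !eqxx (negPf neq_b) (negPf neq_y).
  by [].
have vE : v j = v l.
  have := eq_jl [ffun=> v j]; rewrite !inE !ffunE eqxx => /esym/eqP.
  by [].
move: blockE; rewrite /block; case: ifP => jJ; case: ifP => lJ;
  by [move=> _; apply: v_inj | | | case].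
Qed.

(** The permutation exchanges the coordinates of [j] and [l] and transposes the values [v j] and
    [v l]. As [j] is the only item of [J] in [T], any other item of [T] lives on a third coordinate
    and is fixed. *)
Lemma planted_swap (I V : finType) (J T : {set I}) (v : I -> V) (j l : I) :
  J :&: T \subset [set j] -> j \in J -> l \in T ->
  exists s : {perm {ffun option I -> V}},
    [/\ s @: planted J v j = planted J v l,
        s @: planted J v l = planted J v j
      & forall a, a \in T -> a != j -> a != l ->
          s @: planted J v a = planted J v a].
Proof.
move=> /subsetP JT jJ lT.
have JT' a : a \in T -> a != j -> block J a = Some a.
  move=> aT aj; rewrite /block; case: ifP => // aJ.
  by move: aj; rewrite -in_set1 JT // inE aJ.
have [->|lj] := eqVneq l j.
  by exists 1%g; split=> *; rewrite (eq_imset (g := id)) ?imset_id // => u;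
    rewrite perm1.
pose cj := block J j; pose cl := block J l.
have cjE : cj = None by rewrite /cj /block jJ.
have clE : cl = Some l by apply: JT'.
pose r := tperm (v j) (v l).
pose f (u : {ffun option I -> V}) : {ffun option I -> V} :=
  [ffun c => if c == cj then r (u cl) else if c == cl then r (u cj) else u c].
have f_inv : involutive f.
  move=> u; apply/ffunP=> c; rewrite !ffunE !eqxx cjE clE /=.
  by case: eqP => [->|_]; [|case: eqP => [->|]//]; rewrite tpermK.
pose s := perm (inv_inj f_inv).
have sE a b : (forall u, (f u (block J b) == v b) = (u (block J a) == v a)) ->
    s @: planted J v a = planted J v b.
  move=> fE; apply/setP=> u; rewrite -[u]f_inv -[f (f u)](permE (inv_inj f_inv)).
  by rewrite mem_imset ?inE -?fE ?permE ?f_inv //; apply: perm_inj.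
exists s; split.
- apply: sE => u; rewrite ffunE -/cl -/cj eqxx clE cjE /=.
  by rewrite -{1}[v l](tpermL (v j)) (inj_eq perm_inj).
- apply: sE => u; rewrite ffunE -/cl -/cj eqxx.
  by rewrite -{1}[v j](tpermR _ (v l)) (inj_eq perm_inj).
- move=> a aT aj al; apply: sE => u; rewrite ffunE JT' // cjE clE /=.
  by rewrite (inj_eq Some_inj) (negPf al).
Qed.

(** * Cover sizes in the planted instance *)

(** These functions form a product set, with one value excluded at each coordinate of [Z]. *)
Lemma card_avoiding (R : realFieldType) (D V : finType) (Z : {set D})
    (w : D -> V) : (0 < #|V|)%N ->
  #|[set u : {ffun D -> V} | [forall c in Z, u c != w c]]|%:R =
  #|{ffun D -> V}|%:R * (1 - #|V|%:R^-1) ^+ #|Z| :> R.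
Proof.
move=> V_gt0.
have V_neq0 : #|V|%:R != 0 :> R by rewrite pnatr_eq0 -lt0n.
pose F c : pred V := if c \in Z then predC1 (w c) else predT.
have -> : #|[set u : {ffun D -> V} | [forall c in Z, u c != w c]]| =
          #|(family F : pred {ffun D -> V})|.
  apply: eq_card => u; rewrite inE; apply/forall_inP/familyP => uF c.
    by rewrite /F; case: ifP => // /uF.
  by move=> cZ; have := uF c; rewrite /F cZ.
rewrite card_family foldrE big_map big_enum /= natr_prod.
rewrite card_ffun -prod_nat_const natr_prod -prodr_const.
rewrite [X in _ = _ * X]big_mkcond -big_split /=.
apply: eq_bigr => c _; rewrite /F; case: ifP => _; last by rewrite mulr1.
have := cardC1 (w c); rewrite mulrBr mulr1 mulfV // => ->.
by rewrite -subn1 natrB.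
Qed.

Section PlantedCoverage.

Variables (R : realFieldType) (I V : finType) (J : {set I}) (v : I -> V).
Hypothesis V_gt0 : (0 < #|V|)%N.

Local Notation U := {ffun option I -> V}.
Local Notation K := (#|V|%:R : R).

Lemma card_planted j : #|planted J v j|%:R = #|U|%:R / K.
Proof.
have := @card_avoiding R _ _ [set block J j] (fun=> v j) V_gt0.
have -> : [set u : U | [forall c in [set block J j], u c != v j]] =
          ~: planted J v j.
  apply/setP=> u; rewrite !inE; apply/forall_inP/idP => [|uj c /set1P -> //].
  by apply; rewrite inE.
rewrite cards1 expr1 mulrBr mulr1 -(cardsC (planted J v j)) natrD.
by set x := #|planted J v j|%:R; set y := #|~: _|%:R => yE; lra.
Qed.

(** The items in [J] are charged 1/K each by the union bound. The others sit on separate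
    coordinates, so what they miss is counted by [card_avoiding]. *)
Lemma card_planted_cover (W : {set I}) :
  #|\bigcup_(j in W) planted J v j|%:R <=
  #|U|%:R * (1 - (1 - K^-1) ^+ #|W| + #|W :&: J|%:R / K).
Proof.
have /card_gt0P[y _] := V_gt0.
pose Z : {set option I} := Some @: (W :\: J).
(* [y] is a dummy value: [Z] does not contain [None]. *)
pose w c := if c is Some j then v j else y.
have ltK : 0 <= 1 - K^-1 <= 1.
  rewrite subr_ge0 invf_le1 ?ltr0n // ler1n V_gt0 /=.
  by rewrite lerBlDr lerDl invr_ge0.
have split_cover : \bigcup_(j in W) planted J v j \subset
    \bigcup_(j in W :&: J) planted J v j :|:
    ~: [set u : U | [forall c in Z, u c != w c]].
  apply/bigcupsP => j jW; apply/subsetP => u uj; rewrite inE.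
  have [jJ|jJ] := boolP (j \in J).
    by apply/orP; left; apply/bigcupP; exists j; rewrite // inE jW.
  apply/orP; right; rewrite !inE; apply/negP => /forall_inP/(_ (Some j)).
  rewrite imset_f ?inE ?jJ // => /(_ isT) /negP; apply.
  by move: uj; rewrite inE /block (negPf jJ).
have := leq_trans (subset_leq_card split_cover) (leq_card_setU _ _).
rewrite -(ler_nat R) natrD => /le_trans; apply.
rewrite mulrDr addrC lerD //.
  have := @card_avoiding R _ _ Z w V_gt0.
  have := cardsC [set u : U | [forall c in Z, u c != w c]].
  move/(congr1 (fun t : nat => t%:R : R)); rewrite natrD => cardU boxE.
  have -> : #|~: [set u : U | [forall c in Z, u c != w c]]|%:R =
            #|U|%:R * (1 - (1 - K^-1) ^+ #|Z|) :> R.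
    by rewrite mulrBr mulr1 -boxE -cardU addrC addKr.
  apply: ler_wpM2l => //; rewrite lerB //.
  (* Replacing the exponent |W \ J| by the larger |W| only weakens the bound. *)
  have /andP[K0 K1] := ltK; apply: ler_wiXn2l => //.
  rewrite card_imset; last exact: Some_inj.
  by apply: subset_leq_card; apply: subsetDl.
apply: (@le_trans _ _ (\sum_(j in W :&: J) #|planted J v j|%:R)).
  rewrite -natr_sum ler_nat; elim/big_ind2: _ => [|a A b B aA bB|//].
    by rewrite cards0.
  exact: leq_trans (leq_card_setU _ _) (leq_add aA bB).
under eq_bigr do rewrite card_planted.
by rewrite sumr_const -[leLHS]mulr_natl mulrCA.
Qed.

Lemma planted_cover_opt :
  v @: J = [set: V] -> \bigcup_(j in J) planted J v j = [set: U].
Proof.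
move=> vJ; apply/setP=> u; rewrite inE; apply/bigcupP.
have : u None \in v @: J by rewrite vJ.
by case/imsetP=> j jJ uj; exists j; rewrite // inE /block jJ uj.
Qed.

End PlantedCoverage.

(** * Selection probabilities and the expected core-set value *)

Definition selection_prob (R : realType) (U : finType)
    (ALG : {set {set U}} -> {set {set U}} -> R)
    (T : {set {set U}}) (x : {set U}) : R :=
  \sum_S ALG T S * (x \in S)%:R.

Section SelectionProb.

Variables (R : realType) (U : finType) (k' : R).
Variable ALG : {set {set U}} -> {set {set U}} -> R.
Hypothesis ALG_alg : machine_algorithm k' ALG.

Lemma selection_prob_ge0 T x : 0 <= selection_prob ALG T x.
Proof.
by apply: sumr_ge0 => S _; rewrite mulr_ge0 //; case: (ALG_alg T) => [[]].
Qed.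

Lemma selection_prob_le1 T x : selection_prob ALG T x <= 1.
Proof.
have [[ALG_ge0 <-] _] := ALG_alg T.
by apply: ler_sum => S _; rewrite ler_piMr // lern1; case: (_ \in _).
Qed.

Lemma selection_prob_notin (T : {set {set U}}) x : x \notin T -> selection_prob ALG T x = 0.
Proof.
move=> xT; apply: big1 => S _; apply/eqP; rewrite mulf_eq0.
have [//|/(proj2 (ALG_alg T))[/subsetP ST _]] := eqVneq (ALG T S) 0.
by case: (boolP (x \in S)) => [/ST|_]; [rewrite (negPf xT) | rewrite eqxx orbT].
Qed.

(** The sum is the expected size of the output. *)
Lemma sum_selection_prob T : \sum_x selection_prob ALG T x <= k'.
Proof.
have [[ALG_ge0 ALG_sum] ALG_supp] := ALG_alg T.
rewrite exchange_big /= -[k']mul1r -[X in _ <= X * _]ALG_sum mulr_suml.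
apply: ler_sum => S _; rewrite -mulr_sumr.
have [->|/ALG_supp[_ leS]] := eqVneq (ALG T S) 0; first by rewrite !mul0r.
apply: ler_wpM2l => //; apply: le_trans leS.
rewrite -sum1_card natr_sum [leRHS]big_mkcond /=.
by apply: ler_sum => x _; case: (x \in S).
Qed.

End SelectionProb.

Lemma best_le (R : realType) (I : finType) (f : {set I} -> R) (k : nat)
    (S : {set I}) (c : R) :
  0 <= c ->
  (forall S' : {set I}, S' \subset S -> (#|S'| <= k)%N -> f S' <= c) ->
  best f k S <= c.
Proof.
move=> c_ge0 fc; rewrite /best; elim/big_ind: _ => // [x y xc yc|S' /andP[]].
  by rewrite ge_max xc.
exact: fc.
Qed.

Lemma le_best (R : realType) (I : finType) (f : {set I} -> R) (k : nat)
    (S S' : {set I}) :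
  S' \subset S -> (#|S'| <= k)%N -> f S' <= best f k S.
Proof.
by move=> S'S S'k; apply: (@le_bigmax_cond _ _ _ _ _ _ f); rewrite S'S.
Qed.

Lemma receivedE (U : finType) (n m : nat) (A : {ffun 'I_n -> {set U}})
    (X : {ffun 'I_n -> {set 'I_m}}) (i : 'I_m) :
  received A X i = A @: [set j | i \in X j].
Proof.
by apply/setP=> x; apply/imsetP/imsetP => -[j jX ->]; exists j;
  rewrite // ?inE // in jX *.
Qed.

Section ExpectedValue.

Variables (R : realType) (U : finType) (n m k : nat) (k' : R).
Variable D : 'I_n -> {set 'I_m} -> R.
Variable ALG : {set {set U}} -> {set {set U}} -> R.
Hypothesis D_distr : forall j, is_distr (D j).
Hypothesis ALG_alg : machine_algorithm k' ALG.

(** A bound on [best] that is affine in the number of items of [J] present reduces the expectation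
    to selection probabilities, one machine and one item at a time. *)
Lemma expected_coreset_value_le (A : {ffun 'I_n -> {set U}})
    (J : {set 'I_n}) (a b : R) : 0 <= b ->
  (forall S : {set {set U}}, S \subset items A ->
     best (@coverage R U) k S <= a + b * \sum_(j in J) (A j \in S)%:R) ->
  expected_coreset_value k D ALG A <=
  a + b * \sum_(X : {ffun 'I_n -> {set 'I_m}}) (\prod_j D j (X j)) *
        \sum_i \sum_(j in J) selection_prob ALG (received A X i) (A j).
Proof.
move=> b_ge0 best_le_ab.
have ALG_ge0 T S : 0 <= ALG T S by case: (ALG_alg T) => [[]].
have ALG_sum T : \sum_S ALG T S = 1 by case: (ALG_alg T) => [[]].
have D_ge0 j Y : 0 <= D j Y by case: (D_distr j).
have D_sum j : \sum_Y D j Y = 1 by case: (D_distr j).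
have -> (Z : {ffun 'I_n -> {set 'I_m}} -> R) :
    a + b * \sum_(X : {ffun 'I_n -> {set 'I_m}}) (\prod_j D j (X j)) * Z X =
    \sum_(X : {ffun 'I_n -> {set 'I_m}}) (\prod_j D j (X j)) * (a + b * Z X).
  under [RHS]eq_bigr do rewrite mulrDr mulrCA.
  by rewrite big_split /= -mulr_suml sum_prod_distr // mul1r -mulr_sumr.
apply: ler_sum => X _; apply: ler_wpM2l; first exact: prodr_ge0.
have -> : a + b * (\sum_i \sum_(j in J)
                     selection_prob ALG (received A X i) (A j)) =
  \sum_(O : {ffun 'I_m -> {set {set U}}})
     (\prod_i ALG (received A X i) (O i)) *
     (a + b * \sum_i \sum_(j in J) (A j \in O i)%:R).
  under [RHS]eq_bigr do rewrite mulrDr mulrCA.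
  rewrite big_split /= -mulr_suml.
  rewrite (@sum_prod_distr _ _ _ (fun i => ALG (received A X i))) // mul1r.
  rewrite -mulr_sumr; congr (_ + _ * _).
  under [RHS]eq_bigr do rewrite mulr_sumr.
  rewrite [RHS]exchange_big /=; apply: eq_bigr => i _.
  under [RHS]eq_bigr do rewrite mulr_sumr.
  rewrite [RHS]exchange_big /=; apply: eq_bigr => j _.
  by rewrite (@sum_prod_marginal1 _ _ _ (fun i => ALG (received A X i)) i
                (fun S => (A j \in S)%:R)).
apply: ler_sum => O _.
(* Only outputs of positive probability matter; these are contained in the loads, so [best_le_ab]
   applies to their union. *)
have [->|prod_neq0] := eqVneq (\prod_i ALG (received A X i) (O i)) 0.
  by rewrite !mul0r.
apply: ler_wpM2l; first exact: prodr_ge0.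
have O_sub : \bigcup_i O i \subset items A.
  apply/bigcupsP => i _.
  have Oi : ALG (received A X i) (O i) != 0.
    by apply: contra_neq prod_neq0 => Oi0; rewrite (bigD1 i) //= Oi0 mul0r.
  have [/subset_trans -> //] := proj2 (ALG_alg _) _ Oi.
  by apply/subsetP => x /imsetP[j _ ->]; apply: imset_f.
apply: le_trans (best_le_ab _ O_sub) _; rewrite lerD2l ler_wpM2l //.
(* Union bound: an item of the union is output by at least one machine. *)
rewrite exchange_big /=; apply: ler_sum => j _.
have [/bigcupP[i _ jOi]|_] := boolP (_ \in _); last exact: sumr_ge0.
by rewrite (bigD1 i) //= jOi lerDl sumr_ge0.
Qed.

End ExpectedValue.

(** * Random sending: recipients, collisions and loads *)

(** By symmetry all machines are equally likely to receive the item, and the expected number of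
    recipients is at most [C]. *)
Lemma recipient_prob_le (R : realType) (m C : nat) (D : {set 'I_m} -> R)
    (i : 'I_m) :
  sending_law C D -> m%:R * (\sum_Y D Y * (i \in Y)%:R) <= C%:R.
Proof.
move=> [[D_ge0 D_sum] D_supp D_sym].
have sym l : \sum_Y D Y * (i \in Y)%:R = \sum_Y D Y * (l \in Y)%:R.
  rewrite (reindex_inj (imset_inj (@perm_inj _ (tperm i l)))) /=.
  apply: eq_bigr => Y _.
  rewrite (D_sym _ Y); last by rewrite card_imset //; apply: perm_inj.
  by rewrite -{1}(tpermR i l) mem_imset //; apply: perm_inj.
have -> : m%:R * (\sum_Y D Y * (i \in Y)%:R) =
          \sum_l \sum_Y D Y * (l \in Y)%:R.
  by rewrite -(eq_bigr _ (fun l _ => sym l)) sumr_const card_ord mulr_natl.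
rewrite exchange_big /= -[leRHS]mul1r -[X in _ <= X * _]D_sum mulr_suml.
apply: ler_sum => Y _; rewrite -mulr_sumr.
have [->|/D_supp/andP[_ leY]] := eqVneq (D Y) 0; first by rewrite !mul0r.
apply: ler_wpM2l => //; rewrite -natr_sum ler_nat; apply: leq_trans leY.
by rewrite -sum1_card [leqRHS]big_mkcond /= leq_sum // => l _; case: (l \in Y).
Qed.

Section Sending.

Variables (R : realType) (n m C : nat) (D : 'I_n -> {set 'I_m} -> R).
Hypothesis D_law : forall j, sending_law C (D j).

Let D_ge0 j Y : 0 <= D j Y. Proof. by case: (D_law j) => -[]. Qed.
Let D_sum j : \sum_Y D j Y = 1. Proof. by case: (D_law j) => -[]. Qed.

(** Distinct items are sent independently, so a given pair meets on a given machine with probability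
    at most (C/m)^2; the sum runs over m machines and at most |J|^2 ordered pairs. *)
Lemma collision_le (J : {set 'I_n}) : (0 < m)%N ->
  \sum_(X : {ffun 'I_n -> {set 'I_m}}) (\prod_j D j (X j)) *
    (\sum_i \sum_(j in J) \sum_(l in J :\ j)
        (i \in X j)%:R * (i \in X l)%:R) <=
  #|J|%:R ^+ 2 * C%:R ^+ 2 / m%:R.
Proof.
move=> m_gt0; have m_gt0R : 0 < m%:R :> R by rewrite ltr0n.
under eq_bigr do rewrite mulr_sumr.
rewrite exchange_big /=.
have -> : #|J|%:R ^+ 2 * C%:R ^+ 2 / m%:R =
    \sum_(i < m) \sum_(j in J) \sum_(l in J) (C%:R / m%:R) ^+ 2 :> R.
  rewrite !sumr_const card_ord -!mulrnA -[RHS]mulr_natl !natrM.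
  by field; rewrite gt_eqF.
apply: ler_sum => i _.
under eq_bigr do rewrite mulr_sumr.
rewrite exchange_big /=; apply: ler_sum => j jJ.
under eq_bigr do rewrite mulr_sumr.
(* The right side also counts the diagonal pair l = j, a nonnegative surplus. *)
rewrite exchange_big /= [leRHS](big_setD1 _ jJ) /=.
apply: ler_wpDl; first by rewrite sqr_ge0.
apply: ler_sum => l /setD1P[lj lJ].
rewrite (@sum_prod_marginal2 _ _ _ D j l (fun Y => (i \in Y)%:R)
           (fun Y => (i \in Y)%:R)) 1?eq_sym //.
have p_le a : \sum_Y D a Y * (i \in Y)%:R <= C%:R / m%:R.
  by rewrite ler_pdivlMr // mulrC recipient_prob_le.
by rewrite expr2 ler_pM // sumr_ge0 // => Y _; rewrite mulr_ge0.
Qed.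

(* The expected number of items that a machine draws at random, one from its
   own load, and that turn out to be item [j]. *)
Definition draw_rate (j : 'I_n) : R :=
  \sum_(X : {ffun 'I_n -> {set 'I_m}}) (\prod_l D l (X l)) *
    \sum_i (i \in X j)%:R / #|[set l | i \in X l]|%:R.

(** For a fixed sending, a machine with a nonempty load contributes exactly 1, and an empty one 0
    because the inverse of 0 is 0. *)
Lemma sum_draw_rate : \sum_j draw_rate j <= m%:R.
Proof.
rewrite exchange_big /= -[leRHS]mul1r.
rewrite -[X in _ <= X * _](sum_prod_distr D_sum) mulr_suml.
apply: ler_sum => X _; rewrite -mulr_sumr; apply: ler_wpM2l.
  exact: prodr_ge0.
rewrite exchange_big /= -[X in _ <= X%:R]card_ord -sum1_card natr_sum.
apply: ler_sum => i _; rewrite -mulr_suml -natr_sum.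
have -> : (\sum_j (i \in X j) = #|[set l | i \in X l]|)%N.
  rewrite -sum1_card [RHS]big_mkcond /=.
  by apply: eq_bigr => j _; rewrite inE; case: (i \in X j).
have [->|T_gt0] := posnP #|[set l | i \in X l]|; first by rewrite mul0r.
by rewrite mulfV // pnatr_eq0 -lt0n.
Qed.

End Sending.

(** * Averaging over the planted family *)

Section PlantedFamily.

Variables (R : realType) (n m : nat) (V : finType).
Variables (J : {set 'I_n}) (v : 'I_n -> V).
Hypothesis V_gt1 : (1 < #|V|)%N.
Hypothesis v_inj : {in J &, injective v}.
Hypothesis v_onto : v @: J = [set: V].

Local Notation U := {ffun option 'I_n -> V}.
Local Notation B := (planted J v).

Lemma card_block : #|J| = #|V|.
Proof. by rewrite -cardsT -v_onto card_in_imset. Qed.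

Lemma planted_selection_le (k' : R)
    (ALG : {set {set U}} -> {set {set U}} -> R) (T : {set 'I_n}) :
  0 <= k' -> machine_algorithm k' ALG ->
  \sum_(j in J) \sum_s selection_prob ALG (relabel B s @: T) (relabel B s j) <=
  #|{perm U}|%:R * \sum_(j in J) (k' * ((j \in T)%:R / #|T|%:R) +
     \sum_(l in J :\ j) (j \in T)%:R * (l \in T)%:R).
Proof.
move=> k'_ge0 ALG_alg; rewrite mulr_sumr; apply: ler_sum => j jJ.
have injB : injective B by apply: planted_inj.
have [jT|jT] := boolP (j \in T); last first.
  rewrite big1 => [|s _].
    rewrite mulr_ge0 // addr_ge0 //; first by rewrite mulr_ge0 // divr_ge0.
    by apply: sumr_ge0 => l _; rewrite mulr_ge0.
  rewrite (selection_prob_notin ALG_alg) //.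
  by rewrite mem_imset //; apply: relabel_inj.
have T_gt0 : (0 < #|T|)%N by apply/card_gt0P; exists j.
(* If another item [l] of [J] is in the load, its collision term equals 1 and pays for the trivial
   bound on the probability. Otherwise [j] is alone and exchangeability gives k'/|T|. *)
have [/existsP[l /andP[lJ lT]]|alone] :=
    boolP [exists l, (l \in J :\ j) && (l \in T)].
  apply: (@le_trans _ _ #|{perm U}|%:R).
    rewrite -sum1_card natr_sum; apply: ler_sum => s _.
    exact: selection_prob_le1.
  rewrite ler_peMr // (big_setD1 _ lJ) /= lT !mulr1.
  rewrite addrCA lerDl addr_ge0 //; first by rewrite mulr_ge0 // divr_ge0.
  by apply: sumr_ge0 => a _; rewrite mulr_ge0.
apply: (@le_trans _ _ (#|{perm U}|%:R * (k' / #|T|%:R))); last first.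
  rewrite mul1r ler_wpM2l // lerDl.
  by apply: sumr_ge0 => a _; rewrite mulr_ge0.
rewrite mulrA ler_pdivlMr ?ltr0n // mulrC.
apply: exchangeable_selection => //.
- exact: (selection_prob_ge0 ALG_alg).
- exact: (sum_selection_prob ALG_alg).
- move=> l lT; apply: planted_swap => //; apply/subsetP => a.
  rewrite !inE => /andP[aJ aT]; apply: contraNT alone => aj.
  by apply/existsP; exists a; rewrite !inE aj aJ.
Qed.

(** A candidate [S'] is the relabelled image of an index set [W]; a permutation preserves cover
    sizes, so [card_planted_cover] applies. *)
Lemma planted_best_le (s : {perm U}) (S : {set {set U}}) :
  S \subset items (relabel B s) ->
  best (@coverage R U) #|V| S <=
  #|U|%:R * (1 - (1 - #|V|%:R^-1) ^+ #|V|) +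
  #|U|%:R / #|V|%:R * \sum_(j in J) (relabel B s j \in S)%:R.
Proof.
move=> S_items.
have V_gt0 : (0 < #|V|)%N by apply: ltnW.
have V0 : 0 <= 1 - #|V|%:R^-1 :> R.
  by rewrite subr_ge0 invf_le1 ?ltr0n // ler1n.
have V1 : 1 - #|V|%:R^-1 <= 1 :> R by rewrite lerBlDr lerDl invr_ge0.
apply: best_le => [|S' S'S S'k].
  rewrite addr_ge0 // mulr_ge0 ?divr_ge0 ?sumr_ge0 //.
  by rewrite subr_ge0 exprn_ile1.
pose W := [set j | relabel B s j \in S'].
have relB_inj : injective (relabel B s) by apply/relabel_inj/planted_inj.
have S'E : S' = relabel B s @: W.
  apply/setP=> x; apply/idP/imsetP => [xS'|[j jW ->]]; last first.
    by move: jW; rewrite inE.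
  have /imsetP[j _ xE] := subsetP S_items _ (subsetP S'S _ xS').
  by exists j; rewrite // inE -xE.
have cardW : (#|W| <= #|V|)%N by rewrite -(card_imset _ relB_inj) -S'E.
have coverE : cover S' = s @: \bigcup_(j in W) B j.
  rewrite S'E cover_imset; apply/setP=> x; apply/bigcupP/imsetP.
    move=> [j jW]; rewrite ffunE => /imsetP[u uj ->]; exists u => //.
    by apply/bigcupP; exists j.
  move=> [u /bigcupP[j jW uj] ->]; exists j => //.
  by rewrite ffunE imset_f.
rewrite /coverage coverE card_imset; last exact: perm_inj.
apply: le_trans (card_planted_cover R J v V_gt0 W) _.
rewrite mulrDr lerD //.
  by rewrite ler_wpM2l // lerB // ler_wiXn2l.
rewrite -mulrA ler_wpM2l // mulrC ler_wpM2l ?invr_ge0 //.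
rewrite -natr_sum ler_nat -sum1_card.
rewrite [leqLHS](eq_bigl (fun j => (j \in J) && (j \in W))); last first.
  by move=> j; rewrite inE andbC.
rewrite big_mkcondr /= leq_sum // => j _; rewrite inE.
by case: ifP => // /(subsetP S'S) ->.
Qed.

(** The relabelled items of [J] already cover the whole universe. *)
Lemma planted_best_ge (s : {perm U}) :
  #|U|%:R <= best (@coverage R U) #|V| (items (relabel B s)).
Proof.
have relB_inj : injective (relabel B s) by apply/relabel_inj/planted_inj.
have -> : #|U|%:R = coverage R (relabel B s @: J).
  rewrite /coverage cover_imset -cardsT; congr (_%:R).
  rewrite -(card_imset [set: U] (@perm_inj _ s)) -(planted_cover_opt v_onto).
  apply: eq_card => x; apply/imsetP/bigcupP.
    move=> [u /bigcupP[j jJ uj] ->]; exists j => //.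
    by rewrite ffunE imset_f.
  move=> [j jJ]; rewrite ffunE => /imsetP[u uj ->]; exists u => //.
  by apply/bigcupP; exists j.
apply: le_best; first by apply: imsetS; apply/subsetP.
by rewrite card_imset // card_block.
Qed.

Lemma planted_average_le (C : nat) (D : 'I_n -> {set 'I_m} -> R) (k' : R)
    (ALG : {set {set U}} -> {set {set U}} -> R) :
  (0 < m)%N -> 0 <= k' ->
  (forall j, sending_law C (D j)) -> machine_algorithm k' ALG ->
  \sum_s expected_coreset_value #|V| D ALG (relabel B s) <=
  #|{perm U}|%:R * (#|U|%:R * (1 - (1 - #|V|%:R^-1) ^+ #|V|
    + (k' * \sum_(j in J) draw_rate D j) / #|V|%:R
    + #|V|%:R * C%:R ^+ 2 / m%:R)).
Proof.
move=> m_gt0 k'_ge0 D_law ALG_alg.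
have V_gt0 : 0 < #|V|%:R :> R by rewrite ltr0n ltnW.
have D_distr j : is_distr (D j) by case: (D_law j).
have b_ge0 : 0 <= #|U|%:R / #|V|%:R :> R by rewrite divr_ge0.
apply: (@le_trans _ _ (\sum_(s : {perm U}) _)).
  apply: ler_sum => s _.
  exact: (expected_coreset_value_le D_distr ALG_alg b_ge0 (@planted_best_le s)).
set a := #|U|%:R * (1 - (1 - #|V|%:R^-1) ^+ #|V|).
rewrite big_split /= sumr_const -[a *+ _]mulr_natl -mulr_sumr.
rewrite [X in _ + _ * X <= _]exchange_big /=.
apply: (@le_trans _ _ (#|{perm U}|%:R * a + #|U|%:R / #|V|%:R *
  (#|{perm U}|%:R * (k' * \sum_(j in J) draw_rate D j
     + #|J|%:R ^+ 2 * C%:R ^+ 2 / m%:R)))); last first.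
  rewrite card_block /a le_eqVlt; apply/orP; left; apply/eqP.
  by field; rewrite !gt_eqF // ltr0n.
rewrite lerD // ler_wpM2l //.
(* The average over [s] is taken inside the expectation over sendings, so that
   [planted_selection_le] applies to each machine with its load held fixed as a set of indices. *)
apply: (@le_trans _ _ (\sum_(X : {ffun 'I_n -> {set 'I_m}})
  (\prod_j D j (X j)) * (#|{perm U}|%:R * \sum_i \sum_(j in J)
     (k' * ((i \in X j)%:R / #|[set l | i \in X l]|%:R) +
     \sum_(l in J :\ j) (i \in X j)%:R * (i \in X l)%:R)))).
  apply: ler_sum => X _; rewrite -mulr_sumr; apply: ler_wpM2l.
    by apply: prodr_ge0 => j _; case: (D_distr j).
  rewrite exchange_big mulr_sumr /=; apply: ler_sum => i _.
  rewrite exchange_big /=.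
  under eq_bigr => j _ do under eq_bigr => s _ do rewrite receivedE.
  apply: le_trans (planted_selection_le _ k'_ge0 ALG_alg) _.
  rewrite ler_wpM2l //; apply: ler_sum => j _; rewrite inE lerD //.
  by apply: ler_sum => l _; rewrite inE.
under eq_bigr do rewrite mulrCA.
rewrite -mulr_sumr ler_wpM2l //.
under eq_bigr => X _.
  under [X in _ * X]eq_bigr do rewrite big_split /=.
  rewrite big_split /= mulrDr.
  over.
rewrite big_split /= lerD //; last exact: collision_le.
rewrite /draw_rate exchange_big /= mulr_sumr le_eqVlt; apply/orP; left.
apply/eqP/eq_bigr => X _; rewrite -mulr_sumr mulrCA; congr (_ * _).
rewrite mulr_sumr exchange_big /=; apply: eq_bigr => j _.
by rewrite mulr_sumr.
Qed.

End PlantedFamily.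

(** * Choice of parameters and conclusion *)

Lemma exists_le_average (R : realDomainType) (I : finType) (f : I -> R) (c : R)
    (i0 : I) :
  \sum_i f i <= #|I|%:R * c -> exists i, f i <= c.
Proof.
move=> le_avg; apply/existsP; apply: contraLR le_avg.
rewrite negb_exists -ltNge => /forallP lt_c.
rewrite mulr_natl -sumr_const; apply: ltr_sum.
  by apply/hasP; exists i0; rewrite ?mem_index_enum.
by move=> i _; rewrite ltNge lt_c.
Qed.

Lemma best0 (R : realType) (U : finType) (k : nat) :
  best (@coverage R U) k set0 = 0.
Proof.
apply/eqP; rewrite eq_le; apply/andP; split.
  apply: best_le => // S; rewrite subset0 => /eqP -> _.
  by rewrite /coverage /cover big_set0 cards0.
rewrite -[leLHS](_ : coverage R (set0 : {set {set U}}) = 0).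
  by apply: le_best; rewrite ?cards0.
by rewrite /coverage /cover big_set0 cards0.
Qed.

Lemma expected_coreset_value_lt1 (R : realType) (U : finType) (n m k : nat)
    (k' : R) (D : 'I_n -> {set 'I_m} -> R)
    (ALG : {set {set U}} -> {set {set U}} -> R)
    (A : {ffun 'I_n -> {set U}}) :
  k' < 1 -> machine_algorithm k' ALG ->
  expected_coreset_value k D ALG A = 0.
Proof.
move=> k'_lt1 ALG_alg; apply: big1 => X _.
rewrite [X in _ * X]big1 ?mulr0 // => O _.
have [->|prod_neq0] := eqVneq (\prod_i ALG (received A X i) (O i)) 0.
  by rewrite mul0r.
rewrite [\bigcup_i O i]big1 ?best0 ?mulr0 // => i _.
have Oi : ALG (received A X i) (O i) != 0.
  by apply: contra_neq prod_neq0 => Oi0; rewrite (bigD1 i) //= Oi0 mul0r.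
have [_ /le_lt_trans /(_ k'_lt1)] := proj2 (ALG_alg _) _ Oi.
by rewrite ltrn1 ltnS leqn0 cards_eq0 => /eqP.
Qed.

(** The last three bounds are the error terms of the averaged estimate; they add up to eps/2. *)
Lemma load_bounds (R : realType) (eps : R) (n m k C : nat) :
  0 < eps -> 8 / eps <= k%:R ->
  C%:R <= Num.sqrt (eps * m%:R / (4 * k%:R)) ->
  1 <= eps * (1 - eps) / (8 * C%:R) * (n%:R / m%:R) ->
  [/\ (1 < k)%N, (0 < m)%N, (0 < n)%N, (k <= n)%N &
    [/\ k%:R^-1 <= eps / 8,
    eps * (1 - eps) / (8 * C%:R) * (n%:R / m%:R) * (m%:R / n%:R) <= eps / 8
  & k%:R * C%:R ^+ 2 / m%:R <= eps / 4]].
Proof.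
move=> eps_gt0 k_ge C_le k'_ge1.
have k_gt0 : 0 < k%:R :> R by apply: lt_le_trans k_ge; rewrite divr_gt0.
(* A zero [C], [m] or [n] would make the output bound 0, the inverse of 0 being 0. *)
have C_neq0 : C != 0%N.
  by apply: contraTneq k'_ge1 => ->; rewrite mulr0 invr0 mulr0 mul0r -ltNge.
have m_neq0 : m != 0%N.
  by apply: contraTneq k'_ge1 => ->; rewrite invr0 !mulr0 -ltNge.
have n_neq0 : n != 0%N.
  by apply: contraTneq k'_ge1 => ->; rewrite mul0r mulr0 -ltNge.
have C_ge1 : 1 <= C%:R :> R by rewrite ler1n lt0n.
have m_gt0 : 0 < m%:R :> R by rewrite ltr0n lt0n.
have n_gt0 : 0 < n%:R :> R by rewrite ltr0n lt0n.
have C_gt0 : 0 < C%:R :> R by apply: lt_le_trans C_ge1.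
have eps_lt1 : eps < 1.
  rewrite ltNge; apply/negP => eps_ge1.
  suff : eps * (1 - eps) / (8 * C%:R) * (n%:R / m%:R) <= 0 by lra.
  apply: mulr_le0_ge0; last by rewrite divr_ge0.
  apply: mulr_le0_ge0; last by rewrite invr_ge0 mulr_ge0.
  by rewrite mulr_ge0_le0 ?(ltW eps_gt0) // subr_le0.
have keps : 8 <= k%:R * eps by rewrite -ler_pdivrMr.
(* Squaring the hypothesis on [C] yields this; with [C >= 1] and [eps < 1] it gives k <= m, and [kn]
   then gives m <= n. *)
have kC : 4 * (k%:R * C%:R ^+ 2) <= eps * m%:R.
  have : C%:R ^+ 2 <= eps * m%:R / (4 * k%:R) :> R.
    rewrite -[leRHS]sqr_sqrtr; last first.
      by rewrite divr_ge0 // mulr_ge0 // ltW.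
    by apply: lerXn2r; rewrite ?nnegrE ?sqrtr_ge0.
  rewrite ler_pdivlMr ?mulr_gt0 //; lra.
have kn : m%:R * (8 * C%:R) <= eps * (1 - eps) * n%:R.
  move: k'_ge1; rewrite mulrACA -invfM -[X in X <= _]/1.
  by rewrite ler_pdivlMr ?mul1r ?mulr_gt0 // [_ * m%:R]mulrC.
have k_le_m : k%:R <= m%:R :> R.
  have : 1 * k%:R <= C%:R ^+ 2 * k%:R :> R.
    by rewrite ler_pM2r // exprn_ege1.
  have : eps * m%:R <= 1 * m%:R by rewrite ler_pM2r // ltW.
  lra.
have k_le_n : k%:R <= n%:R :> R.
  apply: le_trans k_le_m _.
  have : 8 * m%:R <= m%:R * (8 * C%:R) :> R.
    by rewrite mulrCA ler_pM2l // ler_peMr // ltW.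
  have : eps * (1 - eps) * n%:R <= 1 * n%:R.
    by rewrite ler_pM2r //; nra.
  lra.
split; rewrite ?lt0n //; try by rewrite -(ler_nat R).
  by rewrite -(ltr_nat R); nra.
split.
- by rewrite invf_ple ?posrE ?divr_gt0 // invf_div.
- have -> : eps * (1 - eps) / (8 * C%:R) * (n%:R / m%:R) * (m%:R / n%:R) =
            eps * (1 - eps) / (8 * C%:R).
    by field; rewrite !gt_eqF.
  rewrite ler_pdivrMr ?mulr_gt0 //.
  have : eps * 1 <= eps * C%:R by rewrite ler_pM2l.
  nra.
- by rewrite ler_pdivrMr //; lra.
Qed.

Theorem theorem4 (R : realType) (eps : R) (n m k C : nat)
    (D : 'I_n -> {set 'I_m} -> R)
    (eps_gt0 : 0 < eps)
    (k_ge : 8 / eps <= k%:R)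
    (C_le : C%:R <= Num.sqrt (eps * m%:R / (4 * k%:R)))
    (D_law : forall j, sending_law C (D j)) :
  exists (U : finType) (F : {set {ffun 'I_n -> {set U}}}),
    [/\ F != set0,
        forall A, A \in F -> injective A
      & forall ALG : {set {set U}} -> {set {set U}} -> R,
          machine_algorithm (eps * (1 - eps) / (8 * C%:R) * (n%:R / m%:R)) ALG ->
          exists2 A, A \in F &
            expected_coreset_value k D ALG A
              <= (1 - (expR 1)^-1 + eps) * best (@coverage R U) k (items A)].
Proof.
set k' := eps * _ / _ * _.
have [k'_lt1|k'_ge1] := ltP k' 1.
  exists 'I_n, [set [ffun j => [set j]]]; split.
  - by apply/set0Pn; exists [ffun j => [set j]]; rewrite set11.
  - by move=> A /set1P -> j l; rewrite !ffunE => /set1_inj.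
  - move=> ALG ALG_alg; exists [ffun j => [set j]]; first exact: set11.
    rewrite (expected_coreset_value_lt1 _ _ _ k'_lt1 ALG_alg) mulr_ge0 //.
      rewrite addr_ge0 ?(ltW eps_gt0) // subr_ge0 invf_le1 ?expR_gt0 //.
      by rewrite -[leLHS]expR0 ler_expR.
    by apply: le_trans (le_best _ (sub0set _) _); rewrite ?cards0.
have [k_gt1 m_gt0 n_gt0 le_kn [k_inv k'_le kC_le]] :=
  load_bounds eps_gt0 k_ge C_le k'_ge1.
have k'_ge0 : 0 <= k' by apply: le_trans k'_ge1.
(* [J] is chosen from [D] alone, so the family is fixed before the algorithm is given. *)
have [|J cardJ light_J] := @light_subset R 'I_n (draw_rate D) k.
  by rewrite card_ord.
have [j0 j0J] : exists j, j \in J.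
  by apply/card_gt0P; rewrite cardJ ltnW.
pose v := enum_rank_in j0J.
have cardV : #|'I_(#|J|)| = k by rewrite card_ord.
have v_inj : {in J &, injective v}.
  by move=> a b aJ bJ; apply: (enum_rank_in_inj aJ bJ).
have v_onto : v @: J = [set: 'I_(#|J|)].
  apply/setP=> i; rewrite inE; apply/imsetP; exists (enum_val i).
    exact: enum_valP.
  by rewrite /v enum_valK_in.
have V_gt1 : (1 < #|'I_(#|J|)|)%N by rewrite cardV.
pose U := {ffun option 'I_n -> 'I_(#|J|)}.
pose B := planted J v.
exists U, [set relabel B s | s : {perm U}]; split.
- by apply/set0Pn; exists (relabel B 1%g); apply: imset_f.
- by move=> A /imsetP[s _ ->]; apply/relabel_inj/planted_inj.
move=> ALG ALG_alg.
have avg := planted_average_le V_gt1 v_inj v_onto m_gt0 k'_ge0 D_law ALG_alg.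
(* Some relabelling does no better for the algorithm than the average. *)
have [s le_s] := exists_le_average 1%g avg.
exists (relabel B s); first exact: imset_f.
rewrite -[in leLHS]cardV; apply: le_trans le_s _.
have := planted_best_ge R V_gt1 v_inj v_onto s; rewrite cardV => opt.
have c_ge0 : 0 <= 1 - (expR 1)^-1 + eps.
  rewrite addr_ge0 ?(ltW eps_gt0) // subr_ge0 invf_le1 ?expR_gt0 //.
  by rewrite -[leLHS]expR0 ler_expR.
apply: le_trans (ler_wpM2l c_ge0 opt).
rewrite mulrC ler_wpM2r //.
(* The lightness of [J] and [sum_draw_rate] bound its total rate by k m/n, leaving k' m/n after
   division by k. *)
have sum_J : (k' * \sum_(j in J) draw_rate D j) / k%:R <= eps / 8.
  apply: le_trans k'_le; rewrite -/k' -mulrA ler_wpM2l //.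
  rewrite ler_pdivrMr ?ltr0n ?(ltnW k_gt1) // mulrAC ler_pdivlMr ?ltr0n //.
  rewrite mulrC; rewrite card_ord in light_J; apply: le_trans light_J _.
  by rewrite mulrC ler_wpM2r // (sum_draw_rate D_law).
have e_le := exp_subinv_ge R (ltnW k_gt1).
by clear -eps_gt0 k_inv sum_J kC_le e_le; lra.
Qed.
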